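(* Let $A\in\mathbb{R}^{d\times n}$ have columns $a_1,\dots,a_n$, let $\lambda>0$, and let $f:\mathbb{R}^d\to\mathbb{R}$ be convex and $L$-smooth. Let $x^\star$ be an optimal solution of $$\min_{x\in\mathbb{R}^n} f(Ax)+\lambda\|x\|_1 .$$ Then for every $x\in\mathbb{R}^n$ and every $i\in\{1,\dots,n\}$, $$|a_i^\top\nabla f(Ax)|<\lambda-\|a_i\|_2\sqrt{2L\,G(x)}\ \Longrightarrow\ x_i^\star=0 ,$$ where $G(x)$ is the duality gap.
   Context: $L$-smooth means differentiable with $L$-Lipschitz gradient in the Euclidean norm. The duality gap at $x$ of a problem $\min_x f(Ax)+g(x)$, with $f$ differentiable and $g$ closed convex, is $G(x)=f(Ax)+g(x)+f^*(w(x))+g^*(-A^\top w(x))\in[0,+\infty]$ with $w(x)=\nabla f(Ax)$, where $h^*(v)=\sup_u v^\top u-h(u)$ is the convex conjugate. Here $g=\lambda\|\cdot\|_1$. The hypothesis of the implication is considered not to hold when $G(x)=+\infty$. *)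

(* Defs.v *)
From HB Require Import structures.
From mathcomp Require Import all_boot all_order all_algebra.
From mathcomp Require Import all_classical all_reals all_analysis.
Import Order.TTheory GRing.Theory Num.Theory.
Import numFieldNormedType.Exports.

Set Implicit Arguments.
Unset Strict Implicit.
Unset Printing Implicit Defensive.

Local Open Scope classical_set_scope.
Local Open Scope ring_scope.

Definition dotc (R : realType) (n : nat) (u v : 'cV[R]_n) : R :=
  \sum_(i < n) u i 0 * v i 0.

(* The library norm [`|u|] on matrices is the sup norm, hence these. *)
Definition norm2c (R : realType) (n : nat) (u : 'cV[R]_n) : R :=
  Num.sqrt (dotc u u).

Definition norm1c (R : realType) (n : nat) (u : 'cV[R]_n) : R :=
  \sum_(i < n) `|u i 0|.

Definition l1_penalty (R : realType) (n : nat) (lambda : R) (u : 'cV[R]_n) : R :=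
  lambda * norm1c u.

Definition grad (R : realType) (n : nat) (f : 'cV[R]_n -> R) (x : 'cV[R]_n) :
    'cV[R]_n :=
  \col_(i < n) 'D_(delta_mx i 0) f x.

(* Differentiability is with respect to the sup norm; in finite dimension this
   is the same as with respect to the Euclidean norm. *)
Definition smooth (R : realType) (n : nat) (L : R) (f : 'cV[R]_n -> R) : Prop :=
  [/\ 0 <= L,
      forall x, differentiable f x &
      forall x y, norm2c (grad f x - grad f y) <= L * norm2c (x - y)].

Definition conjugate (R : realType) (n : nat) (h : 'cV[R]_n -> R)
    (v : 'cV[R]_n) : \bar R :=
  ereal_sup [set (dotc v u - h u)%:E | u in [set: 'cV[R]_n]].

Definition objective (R : realType) (d n : nat) (A : 'M[R]_(d, n))
    (f : 'cV[R]_d -> R) (g : 'cV[R]_n -> R) (x : 'cV[R]_n) : R :=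
  f (A *m x) + g x.

Definition optimal (R : realType) (n : nat) (F : 'cV[R]_n -> R)
    (xs : 'cV[R]_n) : Prop :=
  forall x, F xs <= F x.

(* No conjugate takes the value -oo (the supremum is over a nonempty family of
   reals), so the extended-real sum below is never of the form +oo - oo. *)
Definition duality_gap (R : realType) (d n : nat) (A : 'M[R]_(d, n))
    (f : 'cV[R]_d -> R) (g : 'cV[R]_n -> R) (x : 'cV[R]_n) : \bar R :=
  let w := grad f (A *m x) in
  ((objective A f g x)%:E + conjugate f w + conjugate g (- (A^T *m w)))%E.

(* Main.v *)
Require Import Defs.
From HB Require Import structures.
From mathcomp Require Import all_boot all_order all_algebra.
From mathcomp Require Import all_classical all_reals all_analysis.
From mathcomp Require Import ring lra.
Import Order.TTheory GRing.Theory Num.Theory.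
Import numFieldNormedType.Exports.

(* Put y = A x, y* = A x*, w = grad f y and w* = grad f y*. Bounding the two
   conjugates in G(x) below by their values at y and x*, and the objective at x
   by the one at x*, leaves the Bregman divergence
   f y* - f y - <w, y* - y> <= G(x). For a convex L-smooth f this divergence is
   at least |w* - w|^2 / (2 L), so |w* - w| <= sqrt (2 L G(x)), and by
   Cauchy-Schwarz the hypothesis forces |<a_i, w*>| < lambda. If x*_i were
   nonzero, shrinking it would be a descent direction. *)

Set Implicit Arguments.
Unset Strict Implicit.
Unset Printing Implicit Defensive.

Local Open Scope classical_set_scope.
Local Open Scope ring_scope.

(** * The Euclidean inner product and norm *)

Section dotc.
Context {R : realType} {n : nat}.
Implicit Types u v w : 'cV[R]_n.

Lemma dotcC u v : dotc u v = dotc v u.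
Proof. by apply: eq_bigr => i _; rewrite mulrC. Qed.

Lemma dotcDr u v w : dotc u (v + w) = dotc u v + dotc u w.
Proof. by rewrite -big_split; apply: eq_bigr => i _; rewrite mxE mulrDr. Qed.

Lemma dotcZr a u v : dotc u (a *: v) = a * dotc u v.
Proof. by rewrite mulr_sumr; apply: eq_bigr => i _; rewrite mxE mulrCA. Qed.

Lemma dotcNr u v : dotc u (- v) = - dotc u v.
Proof. by rewrite -scaleN1r dotcZr mulN1r. Qed.

Lemma dotcBr u v w : dotc u (v - w) = dotc u v - dotc u w.
Proof. by rewrite dotcDr dotcNr. Qed.

Lemma dotcBl u v w : dotc (u - v) w = dotc u w - dotc v w.
Proof. by rewrite dotcC dotcBr !(dotcC w). Qed.

Lemma dotcZl a u v : dotc (a *: u) v = a * dotc u v.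
Proof. by rewrite dotcC dotcZr dotcC. Qed.

Lemma dotcNl u v : dotc (- u) v = - dotc u v.
Proof. by rewrite dotcC dotcNr dotcC. Qed.

Lemma dotc_ge0 u : 0 <= dotc u u.
Proof. by apply: sumr_ge0 => i _; rewrite -expr2 sqr_ge0. Qed.

Lemma norm2c_ge0 u : 0 <= norm2c u.
Proof. exact: sqrtr_ge0. Qed.

Lemma sqr_norm2c u : norm2c u ^+ 2 = dotc u u.
Proof. by rewrite sqr_sqrtr ?dotc_ge0. Qed.

Lemma norm2cZ a u : norm2c (a *: u) = `|a| * norm2c u.
Proof.
by rewrite /norm2c dotcZl dotcZr mulrA -expr2 sqrtrM ?sqr_ge0// sqrtr_sqr.
Qed.

Lemma dotc_eq0 u : dotc u u = 0 -> u = 0.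
Proof.
move/eqP; rewrite psumr_eq0 => [/allP u0|i _]; last by rewrite -expr2 sqr_ge0.
apply/colP => i; rewrite mxE; apply/eqP.
by have := u0 i (mem_index_enum _); rewrite /= -expr2 sqrf_eq0.
Qed.

Lemma norm_dotc_le u v : `|dotc u v| <= norm2c u * norm2c v.
Proof.
rewrite -ler_sqr ?nnegrE ?mulr_ge0 ?norm2c_ge0//.
rewrite real_normK ?num_real// exprMn !sqr_norm2c.
have := dotc_ge0 v; rewrite le_eqVlt => /predU1P[/esym v0|v_gt0].
  by rewrite v0 mulr0 (dotc_eq0 v0) -(scale0r v) dotcZr mul0r expr0n.
(* Up to the factor [dotc v v], this vector is the component of [u] orthogonal to [v]; its squared
   norm is [dotc v v] times the defect in Cauchy-Schwarz. *)
have := dotc_ge0 (dotc v v *: u - dotc u v *: v).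
rewrite dotcBl !dotcBr !dotcZl !dotcZr (dotcC v u) => ge0.
rewrite -subr_ge0 -(pmulr_rge0 _ v_gt0).
by apply: le_trans ge0 _; rewrite le_eqVlt; apply/orP; left; apply/eqP; ring.
Qed.

End dotc.

Lemma dotc_mulmx {R : realType} {d n : nat} (A : 'M[R]_(d, n))
    (w : 'cV[R]_d) (u : 'cV[R]_n) : dotc (A^T *m w) u = dotc w (A *m u).
Proof.
have dotE m (a b : 'cV[R]_m) : dotc a b = (a^T *m b) 0 0.
  by rewrite mxE; apply: eq_bigr => k _; rewrite mxE.
by rewrite !dotE trmx_mul trmxK mulmxA.
Qed.

(** Stands in for letting [t] tend to 0 once a first-order inequality has been divided by [t]. *)
Lemma ler_addM_small {R : realFieldType} (a b c : R) :
  (forall t, 0 < t <= 1 -> a <= b + t * c) -> a <= b.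
Proof.
move=> H; apply/ler_addgt0Pr => e e0.
set k := 1 + `|c| / e.
have k1 : 1 <= k by rewrite lerDl divr_ge0// ltW.
have k0 : 0 < k by exact: lt_le_trans k1.
apply: (le_trans (H k^-1 _)); first by rewrite invr_gt0 k0 invf_le1.
rewrite lerD2l ler_pdivrMl//; apply: (le_trans (ler_norm c)).
by rewrite /k mulrDl mul1r divfK ?gt_eqF// lerDr ltW.
Qed.

(** * Gradients and derivatives along lines *)

Section gradient.
Context {R : realType} {n : nat}.
Variable f : 'cV[R]_n -> R.

Lemma diff_grad y h : differentiable f y -> 'd f y h = dotc (grad f y) h.
Proof.
move=> fy; rewrite [in LHS](matrix_sum_delta h) linear_sum.
apply: eq_bigr => i _.
rewrite big_ord1 linearZ /= mxE deriveE// mulrC; congr (_ * _).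
Qed.

Lemma is_derive_line y h t : differentiable f (y + t *: h) ->
  is_derive t 1 (fun s => f (y + s *: h)) (dotc (grad f (y + t *: h)) h).
Proof.
move=> df; rewrite -diff_grad// -deriveE//.
have eq :
    (fun k : R => k^-1 *: (((fun s : R => f (y + s *: h)) \o shift t) (k *: 1)
                           - f (y + t *: h))) =
    (fun k : R => k^-1 *: ((f \o shift (y + t *: h)) (k *: h)
                           - f (y + t *: h))).
  apply/funext => k /=; congr (_ *: (f _ - _)).
  by rewrite scalerDl [k *: 1]mulr1 addrCA.
have dh : derivable f (y + t *: h) h by exact: diff_derivable.
by apply: DeriveDef; rewrite /derivable /derive eq.
Qed.

End gradient.

(** * Inequalities for smooth and convex functions *)

Section smooth.
Context {R : realType} {n : nat} {L : R}.
Variable f : 'cV[R]_n -> R.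
Hypothesis f_smooth : smooth L f.

Lemma smooth_upper y h :
  f (y + h) <= f y + dotc (grad f y) h + L / 2 * dotc h h.
Proof.
have [L_ge0 df lipf] := f_smooth.
pose D t := dotc (grad f (y + t *: h)) h.
(* The claim is [phi 1 <= phi 0]. By the mean value theorem it suffices that the derivative of [phi]
   is nonpositive at some [c], which follows from Cauchy-Schwarz and the Lipschitz gradient. *)
pose phi (t : R) :=
  f (y + t *: h) - (t * dotc (grad f y) h + t ^+ 2 * (L / 2 * dotc h h)).
have dphi (t : R) :
    is_derive t (1 : R) phi (D t - (dotc (grad f y) h + t * (L * dotc h h))).
  have := is_derive_line (df (y + t *: h)) => ?.
  have -> : phi = (fun s => f (y + s *: h)) -
     (dotc (grad f y) h \*: @idfun R + (L / 2 * dotc h h) \*: (@idfun R ^+ 2)).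
    by apply/funext => s; rewrite /phi !fctE /= /GRing.scale /=; ring.
  by apply: is_derive_eq; rewrite /D /GRing.scale /=; field.
have [|c c01] := @MVT R phi _ 0 1 ltr01 (fun t _ => dphi t).
  by apply: derivable_within_continuous => t _; exact: ex_derive.
have c_ge0 : 0 <= c by move: c01; rewrite in_itv/= => /andP[/ltW].
have : D c - dotc (grad f y) h <= c * (L * dotc h h).
  rewrite -dotcBl; apply: le_trans (ler_norm _) _.
  apply: le_trans (norm_dotc_le _ _) _.
  apply: (le_trans (ler_wpM2r (norm2c_ge0 _) (lipf _ _))).
  by rewrite addrAC subrr add0r norm2cZ ger0_norm// -sqr_norm2c expr2; lra.
rewrite /phi scale1r scale0r addr0; lra.
Qed.

(* The sharp constant is [L / 2]; only the order of the last term matters. *)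
Lemma smooth_lower y h :
  f y + dotc (grad f y) h - 3 / 2 * L * dotc h h <= f (y + h).
Proof.
have [L_ge0 _ lipf] := f_smooth.
(* Going back from [y + h] to [y] costs [L / 2]; replacing the gradient at [y + h] by the one at [y]
   costs another [L]. *)
have := smooth_upper (y + h) (- h); rewrite addrK dotcNr dotcNr dotcNl.
have : `|dotc (grad f (y + h) - grad f y) h| <= L * dotc h h.
  apply: le_trans (norm_dotc_le _ _) _.
  apply: (le_trans (ler_wpM2r (norm2c_ge0 _) (lipf _ _))).
  by rewrite addrAC subrr add0r -sqr_norm2c expr2 mulrA.
by rewrite dotcBl ler_norml => /andP[]; lra.
Qed.

Hypothesis f_convex : convex_function [set: convex_lmodType 'cV[R]_n] f.

(** At [y + t *: h], the chord bounds [f] above and [smooth_lower] bounds it below; after division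
    by [t] the error is linear in [t]. *)
Lemma convex_grad_le y z : f y + dotc (grad f y) (z - y) <= f z.
Proof.
set h := z - y.
apply: (@ler_addM_small _ _ _ (3 / 2 * L * dotc h h)) => t /andP[t0 t1].
have : f (t *: z + (1 - t) *: y) <= t * f z + (1 - t) * f y :=
  @f_convex (Itv01 (ltW t0) t1) z y (in_setT _) (in_setT _).
have -> : t *: z + (1 - t) *: y = y + t *: h.
  by rewrite scalerBl scale1r /h scalerBr addrCA.
have := smooth_lower y (t *: h); rewrite !dotcZr dotcZl => lo up.
rewrite -(ler_pM2l t0) !mulrDr; lra.
Qed.

Lemma sqr_norm2c_grad_le y z :
  norm2c (grad f z - grad f y) ^+ 2 <=
  2 * L * (f z - f y - dotc (grad f y) (z - y)).
Proof.
have [L_ge0 _ lipf] := f_smooth; set g := grad f z - grad f y.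
(* When [L] is 0 the gradient is constant. This case is separate because [L^-1] would then be 0 and
   the step below would not move [z]. *)
move: L_ge0; rewrite le_eqVlt => /predU1P[L0|L0].
  have := lipf z y; rewrite -L0 mul0r -/g => g0.
  have -> : norm2c g = 0 by apply/eqP; rewrite eq_le g0 norm2c_ge0.
  by rewrite mulr0 mul0r expr0n.
(* [z - L^-1 *: g] minimizes the quadratic upper bound at [z] on the Bregman
   divergence from [y]. *)
have := convex_grad_le y (z - L^-1 *: g).
have := smooth_upper z (- (L^-1 *: g)).
rewrite !dotcNr dotcNl opprK !dotcZr dotcZl => up.
rewrite (addrAC z) [X in f y + X]dotcBr dotcZr => lo.
have dg : dotc (grad f z) g - dotc (grad f y) g = dotc g g by rewrite -dotcBl.
have H : L^-1 * dotc g g / 2 <= f z - f y - dotc (grad f y) (z - y).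
  have E : L / 2 * (L^-1 * (L^-1 * dotc g g)) = L^-1 * dotc g g / 2.
    by field; rewrite gt_eqF.
  have dgL := congr1 ( *%R L^-1) dg; rewrite mulrBr in dgL.
  lra.
rewrite sqr_norm2c; move: H; rewrite -(ler_pM2l (_ : 0 < 2 * L)) ?mulr_gt0//.
apply: le_trans; rewrite le_eqVlt; apply/orP; left; apply/eqP; field.
by rewrite gt_eqF.
Qed.
End smooth.

(** * The duality gap and the l1 penalty *)

Lemma conjugate_ge {R : realType} {n : nat} (h : 'cV[R]_n -> R)
    (v u : 'cV[R]_n) :
  ((dotc v u - h u)%:E <= conjugate h v)%E.
Proof. by apply: ereal_sup_ubound; exists u. Qed.

Lemma norm1c_shrink {R : realType} {n : nat} (u : 'cV[R]_n) (i : 'I_n) (t : R) :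
  t <= 1 ->
  norm1c (u - (t * u i 0) *: delta_mx i 0) = norm1c u - t * `|u i 0|.
Proof.
(* Entry [i] becomes [(1 - t) * u i 0], and [t <= 1] lets the factor leave the absolute value. *)
move=> t1; rewrite /norm1c (bigD1 i)//= [in RHS](bigD1 i)//= !mxE !eqxx mulr1.
rewrite -{1}(mul1r (u i 0)) -mulrBl normrM ger0_norm ?subr_ge0// mulrBl mul1r.
rewrite addrAC; congr (_ + _ - _); apply: eq_bigr => j /negbTE ji.
by rewrite !mxE ji mulr0 subr0.
Qed.

Section lasso.
Context {R : realType} {d n : nat}.
Variables (A : 'M[R]_(d, n)) (f : 'cV[R]_d -> R) (xs : 'cV[R]_n).

Lemma bregman_le_duality_gap (g : 'cV[R]_n -> R) (x : 'cV[R]_n) :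
  optimal (objective A f g) xs -> (duality_gap A f g x < +oo)%E ->
  f (A *m xs) - f (A *m x) - dotc (grad f (A *m x)) (A *m xs - A *m x)
    <= fine (duality_gap A f g x).
Proof.
move=> /(_ x) opt; set G := duality_gap A f g x => Goo.
set w := grad f (A *m x).
(* Each supremum in the gap is replaced by one of its terms, at [A *m x] and at [xs]. This real
   lower bound also excludes [-oo], so [fine] loses nothing. *)
pose r := objective A f g x + (dotc w (A *m x) - f (A *m x))
          + (dotc (- (A^T *m w)) xs - g xs).
have rG : (r%:E <= G)%E by rewrite !EFinD !leeD ?conjugate_ge.
have Gfin : G \is a fin_num.
  by rewrite fin_real// Goo (lt_le_trans (ltNyr r)).
have : r <= fine G by rewrite -lee_fin fineK.
apply: le_trans; rewrite /r dotcNl dotc_mulmx dotcBr.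
by move: opt; rewrite /objective; lra.
Qed.

Variables (L lambda : R).
Hypothesis f_smooth : smooth L f.

(** Shrinking entry [i] by a fraction [t] lowers the penalty by [lambda * t * |s|], while the smooth
    part grows by at most [t * |s * dotc a w|] plus a term in [t ^+ 2]. Optimality, divided by [t],
    compares the two rates. *)
Lemma lasso_fermat (i : 'I_n) :
  optimal (objective A f (l1_penalty lambda)) xs -> xs i 0 != 0 ->
  lambda <= `|dotc (col i A) (grad f (A *m xs))|.
Proof.
move=> opt xi_neq0; set w := grad f _; set a := col i A; set s := xs i 0.
have s_gt0 : 0 < `|s| by rewrite normr_gt0.
rewrite -(ler_pM2l s_gt0) -normrM.
apply: (@ler_addM_small _ _ _ (L / 2 * (s ^+ 2 * dotc a a))) => t /andP[t0 t1].
have := opt (xs - (t * s) *: delta_mx i 0).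
rewrite /objective /l1_penalty norm1c_shrink// mulmxBr -scalemxAr -colE -/a.
have := smooth_upper f_smooth (A *m xs) (- ((t * s) *: a)).
rewrite !dotcNr dotcNl opprK !dotcZr dotcZl -/w => up le.
have le1 := ler_norm (- (s * dotc a w)); rewrite normrN (dotcC a) in le1.
rewrite (dotcC a w); apply: le_trans (lerD le1 (lexx _)).
rewrite -(ler_pM2l t0); lra.
Qed.

End lasso.

Theorem theorem16 (R : realType) (d n : nat) (A : 'M[R]_(d, n))
    (lambda L : R) (f : 'cV[R]_d -> R) (xs : 'cV[R]_n)
    (lambda_gt0 : 0 < lambda)
    (f_convex : convex_function [set: convex_lmodType 'cV[R]_d] f)
    (f_smooth : smooth L f)
    (xs_optimal : optimal (objective A f (l1_penalty lambda)) xs)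
    (x : 'cV[R]_n) (i : 'I_n) :
  (duality_gap A f (l1_penalty lambda) x < +oo)%E ->
  `|dotc (col i A) (grad f (A *m x))| <
    lambda - norm2c (col i A) *
      Num.sqrt (2 * L * fine (duality_gap A f (l1_penalty lambda) x)) ->
  xs i 0 = 0.
Proof.
move=> Goo; set G := fine _ => screen; set w := grad f _ in screen.
apply/eqP; apply: contraTT screen => /(lasso_fermat f_smooth xs_optimal).
set ws := grad f (A *m xs) => fermat; rewrite -leNgt lerBlDr.
have [L_ge0 _ _] := f_smooth.
have dist : norm2c (ws - w) <= Num.sqrt (2 * L * G).
  rewrite -[leLHS]ger0_norm ?norm2c_ge0// -sqrtr_sqr ler_wsqrtr//.
  apply: le_trans (sqr_norm2c_grad_le f_smooth f_convex _ _) _.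
  by rewrite ler_wpM2l ?mulr_ge0// bregman_le_duality_gap.
(* Splitting [ws] as [w + (ws - w)] isolates the computable correlation from an error controlled by
   [dist]. *)
apply: le_trans fermat _; rewrite -[ws](subrK w) addrC dotcDr.
apply: le_trans (ler_normD _ _) _; rewrite lerD2l.
apply: le_trans (norm_dotc_le _ _) _.
by rewrite ler_wpM2l ?norm2c_ge0.
Qed.
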